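(* Let $\epsilon>0$ be a constant. There is a deterministic CONGEST algorithm that, on an $n$-node graph $G$ with arboricity $\alpha$ and nonnegative node weights, computes an $O(\alpha^{2})$-approximation for MWIS in $O(\log n+\mathtt{COL}(n,(2+\epsilon)\cdot \alpha)+\sqrt{\alpha\log n})$ rounds, where $\mathtt{COL}(n,\Delta)$ denotes the round complexity of computing a $(\Delta+1)$-coloring (proper node coloring with $\Delta+1$ colors) of an $n$-node graph with maximum degree $\Delta$ in the CONGEST model.
   Context: The arboricity $\alpha$ of $G$ is the smallest integer such that the edge set can be partitioned into $\alpha$ forests. MWIS: given weights $w:V\to\mathbb{R}_{\geq0}$, $OPT(G)$ is the maximum of $w(I)=\sum_{v\in I}w(v)$ over independent sets $I$; an independent set $X$ is a $q$-approximation if $q\cdot w(X)\geq OPT(G)$. CONGEST model: synchronous rounds on the network $G$, unique $O(\log n)$-bit identifiers, $O(\log n)$-bit messages per edge per round; weights representable with $O(\log n)$ bits. Standing assumption: every node knows the value of $\alpha$. *)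

(* Defs.v *)
From HB Require Import structures.
From mathcomp Require Import all_boot all_order all_algebra.
From mathcomp Require Import all_classical all_reals all_analysis.
Set Implicit Arguments.
Unset Strict Implicit.
Unset Printing Implicit Defensive.
Import Order.TTheory GRing.Theory Num.Theory.
Local Open Scope ring_scope.

Record sgraph := SGraph {
  vertex :> finType;
  adj : rel vertex;
  adj_sym : symmetric adj;
  adj_irr : irreflexive adj }.

Arguments adj : clear implicits.

Definition is_forest (V : finType) (e : rel V) : Prop :=
  forall p : seq V, ucycle e p -> (size p <= 2)%N.

(* [c u v] is the index of the forest that contains the edge uv; forests may
   be empty, which does not affect the minimum below. *)
Definition forest_partition (G : sgraph) (k : nat) : Prop :=
  exists c : G -> G -> nat,
    [/\ forall u v, c u v = c v u,
        forall u v, adj G u v -> (c u v < k)%N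
      & forall i : nat, is_forest [rel u v | adj G u v && (c u v == i)]].

Definition is_arboricity (G : sgraph) (alpha : nat) : Prop :=
  forest_partition G alpha /\
  forall k, forest_partition G k -> (alpha <= k)%N.

Definition max_degree_le (G : sgraph) (Delta : nat) : Prop :=
  forall v : G, (#|[set u | adj G v u]| <= Delta)%N.

Definition independent (G : sgraph) (I : {set G}) : bool :=
  [forall u in I, forall v in I, ~~ adj G u v].

Definition weight (R : realType) (G : sgraph) (w : G -> R) (I : {set G}) : R :=
  \sum_(v in I) w v.

(* The default value 0 is the weight of the empty set, which is independent. *)
Definition OPT (R : realType) (G : sgraph) (w : G -> R) : R :=
  \big[Num.max/0]_(I : {set G} | independent I) weight w I.

Definition is_approximation (R : realType) (G : sgraph) (w : G -> R) (q : R)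
    (X : {set G}) : Prop :=
  independent X /\ OPT w <= q * weight w X.

(* Number of binary digits of n, for n > 0. It is never 0, so that the bounds
   [c * nbits n] are Theta(log n) for n >= 2 and do not degenerate at n = 1. *)
Definition nbits (n : nat) : nat := (trunc_log 2 n).+1.

(* A node talks to its neighbours through ports 0, ..., deg - 1: port i of v
   leads to the i-th element of [ports v]. The numbering is arbitrary, and a
   node does not initially know who is behind a port. *)
Record network := Network {
  graph :> sgraph;
  ports : graph -> seq graph;
  ports_uniq : forall v, uniq (ports v);
  portsE : forall u v, (v \in ports u) = adj graph u v;
  ident : graph -> nat;
  ident_inj : injective ident }.

Definition short_idents (cId : nat) (N : network) : Prop :=
  forall v : N, (ident v < 2 ^ (cId * nbits #|N|))%N.

(* What a node knows before the first round; [known_par] is a parameter of the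
   whole network (arboricity or degree bound), [datum] is private. *)
Record local_input (X : Type) := LocalInput {
  known_n : nat;
  known_par : nat;
  own_ident : nat;
  own_degree : nat;
  datum : X }.

Definition input_of (N : network) (par : nat) (X : Type) (x : N -> X) (v : N) :
    local_input X :=
  LocalInput #|N| par (ident v) (size (ports v)) (x v).

(* Local computation is unbounded. [send s i] is the message sent through port
   i; [recv s m] is the new state when [m] lists the received messages in the
   order of the ports. *)
Record algorithm (X Y : Type) := Algorithm {
  state : Type;
  init : local_input X -> state;
  send : state -> nat -> bitseq;
  recv : state -> seq bitseq -> state;
  output : state -> Y }.

Section Execution.
Variables (X Y : Type) (A : algorithm X Y) (N : network).
Variables (par : nat) (x : N -> X).

Fixpoint state_after (t : nat) (v : N) : state A :=
  if t is t'.+1 then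
    recv (state_after t' v)
      [seq send (state_after t' u) (index v (ports u)) | u <- ports v]
  else init A (input_of par x v).

Definition output_after (t : nat) (v : N) : Y := output (state_after t v).

Definition messages_bounded (B T : nat) : Prop :=
  forall (t : nat) (u v : N), (t < T)%N -> adj N u v ->
    (size (send (state_after t u) (index v (ports u))) <= B)%N.

End Execution.

(* Nodes know n and Delta; the network need not be connected. *)
Definition coloring_in (cId cMsg n Delta T : nat) : Prop :=
  exists A : algorithm unit 'I_Delta.+1,
  forall N : network, #|N| = n -> short_idents cId N -> max_degree_le N Delta ->
    messages_bounded A Delta (fun _ : N => tt) (cMsg * nbits n) T /\
    forall u v : N, adj N u v ->
      output_after A Delta (fun _ : N => tt) T u !=
      output_after A Delta (fun _ : N => tt) T v.

(* The infimum is a minimum, or +oo if no number of rounds suffices. *)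
Definition COL (R : realType) (cId cMsg n Delta : nat) : \bar R :=
  ereal_inf [set T%:R%:E | T in [set T | coloring_in cId cMsg n Delta T]]%classic.

(* [dec n] is the number format in use on n-node networks. *)
Definition representable (R : realType) (dec : nat -> bitseq -> R)
    (n b : nat) (x : R) : Prop :=
  exists s : bitseq, (size s <= b)%N /\ dec n s = x.

(* Main.v *)
Require Import Defs.
From HB Require Import structures.
From mathcomp Require Import all_boot all_order all_algebra.
From mathcomp Require Import all_classical all_reals all_analysis.
From mathcomp Require Import zify ring lra.
Set Implicit Arguments.
Unset Strict Implicit.
Unset Printing Implicit Defensive.
Import Order.TTheory GRing.Theory Num.Theory.
Local Open Scope ring_scope.

(* Let d be the integer part of (2+eps)*alpha and b ~ log n. Repeatedly removing
   the nodes with at most d remaining neighbours splits the graph into O(b)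
   layers, because a forest on m nodes has at most m edges, so that only a
   constant fraction of the nodes has a larger degree. Every node has at most d
   neighbours in its own and in later layers; the layers are (d+1)-colored in
   parallel. The colors of each layer are cut into k sublayers of m colors, with
   m ~ sqrt(d b) and k ~ m/b, so that both the total number O(b k) of sublayers
   and m are O(b + sqrt(d b)).

   A forward sweep in the order of a key selects v iff the selected neighbours of
   smaller key weigh together at most w(v); this is one bit per node, where local
   ratio would communicate reduced weights. Unselected nodes are paid for by
   their earlier selected neighbours, so that w(S) >= w(V)/(d+1). A backward sweep
   makes the selection independent; a discarded node is charged to a kept
   neighbour of larger key, which is charged at most its own weight, so that half
   of the weight survives. A forward sweep over the sublayers, a forward and a
   backward sweep over the colors inside all sublayers at once, and a backward
   sweep over the sublayers give an independent set of weight w(V)/(4(d+1)^2). *)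

(** * Forests *)

(** On a longest path inside [A], a neighbour of the end [x] other than its successor would close a
    cycle of at least three nodes. *)
Lemma forest_leaf (V : finType) (e : rel V) (A : {set V}) :
    symmetric e -> irreflexive e -> is_forest e -> A != finset.set0 ->
  exists2 v, v \in A & (#|[set u in A | e v u]| <= 1)%N.
Proof.
move=> esym eirr forest_e /set0Pn[x0 x0A].
pose good (p : seq V) := [&& uniq p, all (mem A) p & (if p is x :: q then path e x q else false)].
have exg : exists n, [exists p : n.-tuple V, good p].
  exists 1%N; apply/existsP; exists [tuple x0].
  by rewrite /good /= x0A.
have bdg n : [exists p : n.-tuple V, good p] -> (n <= #|V|)%N.
  case/existsP => p /and3P[up _ _].
  by rewrite -(size_tuple p) -(card_uniqP up) max_card.
case: (ex_maxnP exg bdg) => n /existsP[p] gp maxn.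
case: p gp => -[|x q] /= szp; rewrite /good //= => /and3P[/andP[xq uq] /andP[xA qA] pq].
exists x => //.
(* An end of a longest path has all its neighbours on the path. *)
have nbrq u : u \in A -> e x u -> u \in q.
  move=> uA exu; case: (boolP (u \in q)) => // uq'.
  have : (n.+1 <= n)%N.
    apply: maxn; apply/existsP.
    have sz' : size (u :: x :: q) == n.+1 by rewrite /= eqSS.
    exists (Tuple sz'); rewrite /good /=.
    rewrite in_cons negb_or uq' xq uq uA xA qA esym exu pq !andbT.
    by apply: contraTneq exu => ->; rewrite eirr.
  by rewrite ltnn.
rewrite leqNgt; apply/negP => /card_gt1P[u [v []]].
rewrite !inE => /andP[uA exu] /andP[vA exv] uv.
(* Of two distinct neighbours of [x], one differs from its successor [head x q] on the path. *)
have {uv uA exu vA exv} [y yA [exy yh]] : exists2 y, y \in A & e x y /\ (y != head x q).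
  case: (eqVneq u (head x q)) => [uE|uE]; last by exists u.
  by exists v => //; split=> //; rewrite -uE eq_sym.
have := nbrq _ yA exy => yq.
case/splitPr: yq uq pq xq yh => q1 q2 uq pq xq yh.
have q1n : q1 != [::] by case: q1 yh {uq pq xq} => //=; rewrite eqxx.
have /forest_e : ucycle e (x :: rcons q1 y).
  rewrite /ucycle /= rcons_path last_rcons esym exy andbT.
  move: pq uq xq; rewrite -cat_rcons cat_path cat_uniq mem_cat negb_or.
  by move=> /andP[-> _] /and3P[-> _ _] /andP[-> _].
by rewrite /= size_rcons; case: q1 q1n {uq pq xq yh}.
Qed.

(** Induction on [A]: deleting a node of degree at most 1 lowers the degree sum by at most 2. *)
Lemma forest_edges (V : finType) (e : rel V) (A : {set V}) :
    symmetric e -> irreflexive e -> is_forest e ->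
  (\sum_(v in A) #|[set u in A | e v u]| <= 2 * #|A|)%N.
Proof.
move=> esym eirr forest_e.
have [n] := ubnP #|A|; elim: n A => // n IH A leAn.
have [->|A0] := eqVneq A finset.set0; first by rewrite big_set0.
have [x xA xdeg] := forest_leaf esym eirr forest_e A0.
have cA : #|A| = #|A :\ x|.+1 by rewrite (cardsD1 x A) xA.
rewrite (big_setD1 x) //=.
have split_deg v : v \in A :\ x ->
    #|[set u in A | e v u]| = (e v x + #|[set u in A :\ x | e v u]|)%N.
  move=> vA; rewrite (cardsD1 x) inE xA /=; congr (_ + _)%N.
  by apply: eq_card => u; rewrite !inE andbA.
rewrite (eq_bigr _ split_deg) big_split /=.
have -> : (\sum_(v in A :\ x) e v x = #|[set u in A | e x u]|)%N.
  rewrite -sum1dep_card [RHS]big_mkcondr [RHS](big_setD1 x) //= eirr add0n.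
  by apply: eq_bigr => v _; rewrite esym; case: (e x v).
have leA'n : (#|A :\ x| < n)%N by rewrite -ltnS -cA.
have := IH (A :\ x) leA'n; rewrite cA.
by move: xdeg; lia.
Qed.

(** Every edge lies in exactly one of the [alpha] forests, so the degree sum splits into [alpha]
    forest degree sums. *)
Lemma arboricity_edges (G : sgraph) (alpha : nat) (A : {set G}) :
    forest_partition G alpha ->
  (\sum_(v in A) #|[set u in A | adj G v u]| <= 2 * alpha * #|A|)%N.
Proof.
move=> [c [csym cltn forest_c]].
have -> : (\sum_(v in A) #|[set u in A | adj G v u]| =
    \sum_(i < alpha) \sum_(v in A) #|[set u in A | adj G v u && (c v u == i)]|)%N.
  rewrite exchange_big /=; apply: eq_bigr => v _.
  under eq_bigr => i _ do rewrite -sum1dep_card big_mkcondr.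
  rewrite exchange_big -sum1dep_card big_mkcondr /=; apply: eq_bigr => u _.
  have [vu|nvu] := boolP (adj G v u); last by rewrite big1.
  by rewrite -big_mkcond /= (big_pred1 (Ordinal (cltn v u vu))) //.
apply: (@leq_trans (\sum_(i < alpha) 2 * #|A|)%N).
  apply: leq_sum => i _; apply: (@forest_edges _ [rel u v | adj G u v && (c u v == i)]).
  - by move=> u v /=; rewrite adj_sym csym.
  - by move=> u /=; rewrite adj_irr.
  - exact: forest_c.
by rewrite sum_nat_const card_ord mulnCA mulnA.
Qed.

(** * Execution of composed and broadcasting algorithms *)

Definition runs (X Y : Type) (A : algorithm X Y) (N : network) (par B T : nat)
    (x : N -> X) (y : N -> Y) : Prop :=
  messages_bounded A par x B T /\ forall v, output_after A par x T v = y v.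

Section Composition.
Variables (X Y Z : Type) (A1 : algorithm X Y) (T1 : nat) (A2 : algorithm Y Z).

Definition set_datum (i : local_input X) (y : Y) : local_input Y :=
  LocalInput (known_n i) (known_par i) (own_ident i) (own_degree i) y.

(* The second component is restarted on the current output of the first one
   until round T1, so that T1 = 0 needs no special treatment. *)
Definition then_start (i : local_input X) (t : nat) (s : state A1) :
    local_input X * nat * state A1 * state A2 :=
  (i, t, s, init A2 (set_datum i (output s))).

Definition run_then : algorithm X Z := {|
  state := local_input X * nat * state A1 * state A2;
  init := fun i => then_start i 0 (init A1 i);
  send := fun '(_, t, s1, s2) =>
    if (t < T1)%N then send s1 else send s2;
  recv := fun '(i, t, s1, s2) ms =>
    if (t < T1)%N then then_start i t.+1 (recv s1 ms)
    else (i, t.+1, s1, recv s2 ms);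
  output := fun '(_, _, _, s2) => output s2 |}.

Variables (N : network) (par B T2 : nat) (x : N -> X).

Let input1 v := input_of par x v.

Let state_then_before t v : (t <= T1)%N ->
  state_after run_then par x t v = then_start (input1 v) t (state_after A1 par x t v).
Proof.
elim: t v => [//|t IH] v ltT /=.
rewrite IH 1?ltnW //= ltT; congr (then_start _ _ (recv _ _)).
by apply/eq_map => u; rewrite IH 1?ltnW //= ltT.
Qed.

Let y := output_after A1 par x T1.

Let state_then_after t v :
  state_after run_then par x (T1 + t) v =
  (input1 v, (T1 + t)%N, state_after A1 par x T1 v, state_after A2 par y t v).
Proof.
elim: t v => [|t IH] v; first by rewrite addn0 state_then_before.
rewrite addnS /= IH /= ltnNge leq_addr /=; congr (_, recv _ _).
by apply/eq_map => u; rewrite IH /= ltnNge leq_addr.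
Qed.

Lemma runs_then (y' : N -> Y) (z : N -> Z) :
    runs A1 par B T1 x y' -> runs A2 par B T2 y' z ->
  runs run_then par B (T1 + T2) x z.
Proof.
move=> [mb1 out1] run2; have yE : y' = y by apply/funext => v; rewrite -out1.
move: run2; rewrite yE => -[mb2 out2]; split=> [t u v ltT uv|v]; last first.
  by rewrite -out2 /output_after state_then_after.
have [ltT1|leT1] := ltnP t T1.
  by rewrite state_then_before 1?(ltnW ltT1) //= ltT1; exact: mb1.
rewrite -(subnKC leT1) state_then_after /= ltnNge leq_addr /=.
by apply: mb2 => //; rewrite ltn_subLR.
Qed.

End Composition.

Section Mirror.
Variables (X D Y : Type) (d0 : D) (enc : X -> nat -> D -> seq D -> bitseq).
Variables (upd : nat -> D -> bitseq -> D) (post : X -> D -> seq D -> Y).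

(* Every node owns a public value and keeps a copy of the public values of its
   neighbours; a round broadcasts a message from which all of them update. *)
Definition mirror : algorithm X Y := {|
  state := X * nat * D * seq D;
  init := fun i => (datum i, 0%N, d0, nseq (own_degree i) d0);
  send := fun '(x, t, own, nbs) _ => enc x t own nbs;
  recv := fun '(x, t, own, nbs) ms =>
    (x, t.+1, upd t own (enc x t own nbs),
     [seq upd t p.1 p.2 | p <- zip nbs ms]);
  output := fun '(x, t, own, nbs) => post x own nbs |}.

Variables (N : network) (par B T : nat) (x : N -> X).

Fixpoint public (t : nat) (v : N) : D :=
  if t is t'.+1 then
    upd t' (public t' v)
      (enc (x v) t' (public t' v) [seq public t' u | u <- ports v])
  else d0.

Let state_mirror t v : state_after mirror par x t v =
  (x v, t, public t v, [seq public t u | u <- ports v]).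
Proof.
elim: t v => [|t IH] v /=; first by congr (_, _); elim: (ports v) => //= ? ? ->.
rewrite IH; congr (_, _).
rewrite zip_map -map_comp; apply: eq_map => u /=.
by rewrite IH.
Qed.

Lemma runs_mirror : (forall z t own nbs, (size (enc z t own nbs) <= B)%N) ->
  runs mirror par B T x
    (fun v => post (x v) (public T v) [seq public T u | u <- ports v]).
Proof.
by move=> encB; split=> [t u v _ _|v]; rewrite ?/output_after state_mirror //=.
Qed.

End Mirror.

Section Sweep.
Variables (X Y : Type) (key : X -> nat) (dec : X -> seq (option (nat * bool)) -> bool).
Variable post : X -> bool -> seq (nat * bool) -> Y.

(** A node speaks only in round [key x], with its one-bit decision. Keys are never sent: the
    receiver reads the key off the round number. *)
Definition sweep_enc (x : X) (t : nat) (_ : option (nat * bool)) nbs : bitseq :=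
  if t == key x then [:: dec x nbs] else [::].

Definition sweep_upd (t : nat) (own : option (nat * bool)) (m : bitseq) :=
  if m is b :: _ then Some (t, b) else own.

Definition sweep : algorithm X Y :=
  mirror None sweep_enc sweep_upd
    (fun x own nbs => post x (odflt (0%N, false) own).2 (map (odflt (0%N, false)) nbs)).

Lemma runs_sweep (N : network) (par B T : nat) (x : N -> X) :
    (0 < B)%N -> (forall v, key (x v) < T)%N ->
  exists2 b : N -> bool,
    forall v, b v = dec (x v)
      [seq if (key (x u) < key (x v))%N then Some (key (x u), b u) else None
      | u <- ports v]
  & runs sweep par B T x
      (fun v => post (x v) (b v) [seq (key (x u), b u) | u <- ports v]).
Proof.
move=> B0 ltT; pose pub := @public _ _ None sweep_enc sweep_upd N x.
pose b v := dec (x v) [seq pub (key (x v)) u | u <- ports v].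
have pubE t v : pub t v = if (key (x v) < t)%N then Some (key (x v), b v) else None.
  elim: t v => [//|t IH] v; rewrite /pub /= -/pub /sweep_enc IH.
  have [tE|tE] := eqVneq t (key (x v)); first by rewrite /= -tE ltnSn /b -tE.
  by rewrite /= ltnS [in RHS]leq_eqVlt eq_sym (negPf tE).
exists b => [v|].
  by rewrite {1}/b; congr (dec _ _); apply: eq_map => u; rewrite pubE.
have encB z t own nbs : (size (sweep_enc z t own nbs) <= B)%N.
  by rewrite /sweep_enc; case: ifP.
have [mb out] := @runs_mirror _ _ Y None sweep_enc sweep_upd
  (fun x own nbs => post x (odflt (0%N, false) own).2 (map (odflt (0%N, false)) nbs))
  N par B T x encB.
split=> [//|v]; rewrite out -/pub pubE ltT /= -map_comp; congr (post _ _ _).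
by apply: eq_map => u /=; rewrite -/pub pubE ltT.
Qed.

End Sweep.

(** * Exchanging weights, peeling, and coloring a subnetwork *)

Lemma count_ports (N : network) (P : pred N) (v : N) :
  count P (ports v) = #|[set u | adj N v u && P u]|.
Proof.
rewrite -size_filter -(card_uniqP _); last exact/filter_uniq/ports_uniq.
by apply: eq_card => u; rewrite inE mem_filter portsE andbC.
Qed.

Section WeightExchange.
Variables (R : realType) (dec : bitseq -> R) (S : nat).

Definition code (w : R) : bitseq :=
  xget [::] [set s : bitseq | (size s <= S)%N /\ dec s = w]%classic.

(** Sending one bit per round respects every positive bandwidth, whatever the ratio of code length
    to message length. *)
Definition exchange : algorithm R (R * seq R) :=
  mirror [::] (fun w t _ _ => take 1 (drop t (code w))) (fun _ own m => own ++ m)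
    (fun w _ nbs => (w, map dec nbs)).

Lemma runs_exchange (N : network) (par B : nat) (w : N -> R) : (0 < B)%N ->
    (forall v, exists s : bitseq, (size s <= S)%N /\ dec s = w v) ->
  runs exchange par B S w (fun v => (w v, [seq w u | u <- ports v])).
Proof.
move=> B0 repr; pose enc := fun w t (_ : bitseq) (_ : seq bitseq) => take 1 (drop t (code w)).
have codeP v : (size (code (w v)) <= S)%N /\ dec (code (w v)) = w v.
  have [s sP] := repr v.
  exact: (@xgetPex _ [::] [set s : bitseq | (size s <= S)%N /\ dec s = w v]%classic (ex_intro _ s sP)).
have encB z t own nbs : (size (enc z t own nbs) <= B)%N.
  by rewrite size_take; case: ltnP => // h; apply: leq_trans B0.
have pubE t v : public [::] enc (fun _ own m => own ++ m) w t v = take t (code (w v)).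
  elim: t v => [|t IH] v /=; first by rewrite take0.
  by rewrite IH /enc -[t.+1]addn1 takeD.
have [mb out] := @runs_mirror _ _ _ [::] enc (fun _ own m => own ++ m)
  (fun w _ nbs => (w, map dec nbs)) N par B S w encB.
split=> // v; rewrite out -map_comp; congr (_, _); apply: eq_map => u /=.
by have [szu codeu] := codeP u; rewrite pubE take_oversize ?codeu.
Qed.

End WeightExchange.

Section Peeling.
Variables (X Y : Type) (d : nat) (post : X -> nat -> seq nat -> Y).

Definition peel_enc (_ : X) (_ : nat) (own : option nat) (nbs : seq (option nat)) : bitseq :=
  if (own == None) && (count (pred1 None) nbs <= d)%N then [:: true] else [::].

Definition peel_upd (t : nat) (own : option nat) (m : bitseq) : option nat :=
  if m is _ :: _ then Some t else own.

Definition peel : algorithm X Y :=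
  mirror None peel_enc peel_upd
    (fun x own nbs => post x (odflt 0%N own) (map (odflt 0%N) nbs)).

Variables (N : network) (par B L : nat) (x : N -> X).

Definition alive (t : nat) : {set N} :=
  iter t (fun A : {set N} => [set v in A | d < #|[set u in A | adj N v u]|]%N)
    [set: N].

(** A neighbour [u] of [v] with [lay v <= lay u] is still alive in round [lay v], and [v] leaves
    only when at most [d] neighbours are alive. *)
Lemma runs_peel : (0 < B)%N -> alive L = finset.set0 ->
  exists2 lay : N -> nat,
    (forall v, lay v < L /\ #|[set u | adj N v u && (lay v <= lay u)]| <= d)%N
  & runs peel par B L x (fun v => post (x v) (lay v) [seq lay u | u <- ports v]).
Proof.
move=> B0 aliveL; pose pub := @public _ _ None peel_enc peel_upd N x.
have pubS t v : pub t.+1 v =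
    if (pub t v == None) && (#|[set u | adj N v u && (pub t u == None)]| <= d)%N
    then Some t else pub t v.
  rewrite {1}/pub /= -/pub /peel_enc count_map count_ports /=.
  by case: ifP.
have aliveE t v : (v \in alive t) = (pub t v == None).
  elim: t v => [|t IH] v; first by rewrite inE.
  rewrite pubS inE IH; case: eqP => [->|/eqP pv] /=; last by rewrite (negPf pv).
  rewrite (_ : [set u in _ | _] = [set u | adj N v u && (pub t u == None)]); last first.
    by apply/setP => u; rewrite !inE IH andbC.
  by rewrite ltnNge; case: ifP.
have pub_lt t v j : pub t v = Some j ->
    (j < t)%N /\ (#|[set u | adj N v u && (pub j u == None)]| <= d)%N.
  elim: t => [//|t IH]; rewrite pubS; case: ifP => [/andP[_ dv] [<-] //|_ /IH[jt ?]].
  by split=> //; exact: ltnW.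
have pub_mono t t' v j : (t <= t')%N -> pub t v = Some j -> pub t' v = Some j.
  move=> /subnKC <-; elim: (t' - t)%N => [|k IH]; first by rewrite addn0.
  by move=> /IH pv; rewrite addnS pubS pv.
pose lay v := odflt 0%N (pub L v).
have layE v : pub L v = Some (lay v).
  rewrite /lay; case pv : (pub L v) => //.
  by have := aliveE L v; rewrite aliveL pv inE.
exists lay => [v|].
  have [ltL dv] := pub_lt _ _ _ (layE v); split=> //.
  apply: leq_trans dv; apply: subset_leq_card; apply/fintype.subsetP => u; rewrite !inE.
  case/andP => -> leuv /=; case pu : (pub (lay v) u) => [j|//].
  have [jlt _] := pub_lt _ _ _ pu.
  have := pub_mono _ _ _ _ (ltnW ltL) pu; rewrite layE => -[juE].
  by move: leuv; rewrite juE leqNgt jlt.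
have encB z t own nbs : (size (peel_enc z t own nbs) <= B)%N.
  by rewrite /peel_enc; case: ifP.
have [mb out] := @runs_mirror _ _ Y None peel_enc peel_upd
  (fun x own nbs => post x (odflt 0%N own) (map (odflt 0%N) nbs)) N par B L x encB.
by split=> [//|v]; rewrite out -map_comp.
Qed.

(** Each survivor has at least [d.+1] neighbours in [alive t]; compare with the degree sum over
    [alive t]. *)
Lemma alive_card (alpha t : nat) : forest_partition N alpha ->
  (d.+1 * #|alive t.+1| <= 2 * alpha * #|alive t|)%N.
Proof.
move=> /arboricity_edges edges; apply: leq_trans (edges (alive t)).
rewrite mulnC -sum_nat_const /=.
have sub : alive t.+1 \subset alive t by apply/fintype.subsetP => v; rewrite inE => /andP[].
rewrite [leqRHS](big_setID (alive t.+1)) /= (finset.setIidPr sub).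
apply: leq_trans (leq_addr _ _); apply: leq_sum => v.
by rewrite inE => /andP[].
Qed.

End Peeling.

(** Translates port numbers between a network and its subnetwork. *)
Lemma index_filter (T : eqType) (P : pred T) (s : seq T) (v : T) : P v ->
  index v (seq.filter P s) = count P (take (index v s) s).
Proof.
move=> Pv; elim: s => //= u s IH; have [->|uv] := eqVneq u v.
  by rewrite Pv /= eqxx.
by rewrite /=; case: (P u); rewrite /= ?(negPf uv) IH.
Qed.

Section Restriction.
Variables (Z Z' : Type) (A : algorithm unit nat) (par' : nat).
Variables (mask : Z -> bitseq) (post : Z -> nat -> Z').

Definition on_subnetwork : algorithm Z Z' := {|
  state := Z * state A;
  init := fun i => (datum i, init A (LocalInput (known_n i) par' (own_ident i)
                                       (count id (mask (datum i))) tt));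
  send := fun '(z, s) i =>
    if nth false (mask z) i then send s (count id (take i (mask z))) else [::];
  recv := fun '(z, s) ms => (z, recv s (seq.mask (mask z) ms));
  output := fun '(z, s) => post z (output s) |}.

Variables (N : network) (lay : N -> nat).

(** The disjoint union of all layers, on all the nodes: a single run of the coloring algorithm, with
    the same n and identifiers, colors every layer at once. *)
Definition sub_adj : rel N := fun u v => adj N u v && (lay u == lay v).

Lemma sub_adj_sym : symmetric sub_adj.
Proof. by move=> u v; rewrite /sub_adj adj_sym eq_sym. Qed.

Lemma sub_adj_irr : irreflexive sub_adj.
Proof. by move=> u; rewrite /sub_adj adj_irr. Qed.

Definition sub_ports (v : SGraph sub_adj_sym sub_adj_irr) : seq (SGraph sub_adj_sym sub_adj_irr) :=
  [seq u <- @ports N v | lay v == lay u].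

Lemma sub_ports_uniq v : uniq (sub_ports v).
Proof. exact/filter_uniq/ports_uniq. Qed.

Lemma sub_portsE u v : (v \in sub_ports u) = adj (SGraph sub_adj_sym sub_adj_irr) u v.
Proof. by rewrite mem_filter portsE andbC. Qed.

Definition sub_network : network :=
  Network sub_ports_uniq sub_portsE (@ident_inj N).

Variables (par B T : nat) (z : N -> Z).
Hypothesis maskE : forall v, mask (z v) = [seq lay v == lay u | u <- ports v].

Lemma runs_on_subnetwork (y : N -> nat) : 
  @runs _ _ A sub_network par' B T (fun=> tt) y ->
  runs on_subnetwork par B T z (fun v => post (z v) (y v)).
Proof.
have st t (v : N) : state_after on_subnetwork par z t v =
    (z v, @state_after _ _ A sub_network par' (fun=> tt) t v).
  elim: t v => [|t IH] v /=.
    by rewrite /input_of /= maskE count_map -size_filter.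
  rewrite IH; congr (_, recv _ _).
  rewrite maskE -map_mask -filter_mask; apply/eq_in_map => u.
  rewrite mem_filter portsE => /andP[luv vu].
  rewrite IH /= maskE (nth_map u) ?index_mem ?portsE ?[adj N u v]adj_sym //.
  rewrite nth_index ?portsE ?[adj N u v]adj_sym // eq_sym luv.
  by rewrite /sub_ports index_filter // -?map_take ?count_map // eq_sym.
move=> [mb out]; split=> [t u v tT uv|v]; last by rewrite /output_after st /= -out.
rewrite st /= maskE (nth_map u) ?index_mem ?portsE // nth_index ?portsE //.
case: ifP => // luv.
have := mb t u v tT; rewrite /= /sub_adj uv luv => /(_ isT).
by rewrite /sub_ports index_filter // -map_take count_map.
Qed.

End Restriction.

(** * Greedy sweeps *)

Section Greedy.
Variables (R : realType) (V : finType) (e : rel V) (r : V -> nat) (w : V -> R).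
Hypothesis w_ge0 : forall v, 0 <= w v.

(** A node of [B] outside [S] weighs less than its earlier neighbours in [S]. After exchanging the
    sums, each selected node is charged by at most [d] later neighbours; the extra 1 is for [S]
    itself. *)
Lemma forward_greedy (d : nat) (B S : pred V) :
    (forall v, S v = B v && (\sum_(u | [&& e v u, (r u < r v)%N & S u]) w u <= w v)) ->
    (forall u, #|[set v | e v u && (r u < r v)%N]| <= d)%N ->
  \sum_(v | B v) w v <= d.+1%:R * \sum_(v | S v) w v.
Proof.
move=> SE outd; rewrite (bigID S) /= -natr1 mulrDl mul1r addrC lerD //; last first.
  by rewrite (eq_bigl S) // => v; rewrite SE; case: (B v).
have -> : d%:R * \sum_(v | S v) w v = \sum_(u | S u) d%:R * w u by rewrite mulr_sumr.
apply: (@le_trans _ _ (\sum_v \sum_(u | [&& e v u, (r u < r v)%N & S u]) w u)).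
  rewrite [leLHS]big_mkcond; apply: ler_sum => v _; case: ifP => [/andP[Bv]|_].
    by rewrite SE Bv /= -ltNge => /ltW.
  by apply: sumr_ge0.
under eq_bigr => v _ do rewrite big_mkcond.
rewrite exchange_big [leRHS]big_mkcond; apply: ler_sum => u _ /=.
case: ifP => _; last by rewrite big1 // => v _; rewrite !andbF.
rewrite -big_mkcond /= sumr_const -[w u *+ _]mulr_natl ler_wpM2r // ler_nat.
apply: leq_trans (outd u); apply: subset_leq_card; apply/fintype.subsetP => v.
by rewrite !inE => /and3P[-> ->].
Qed.

(** The charges to a kept node are part of its sum over [S]. The set [I] is separate from [S]
    because the outer backward sweep starts from a set already thinned by the inner one, while its
    weight bound stems from the outer forward sweep. *)
Lemma backward_greedy (S I X : pred V) : symmetric e ->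
    (forall v, S v -> \sum_(u | [&& e v u, (r u < r v)%N & S u]) w u <= w v) ->
    (forall v, I v -> S v) ->
    (forall v, X v = I v && ~~ [exists u, [&& e v u, (r v < r u)%N & X u]]) ->
  \sum_(v | I v) w v <= 2 * \sum_(v | X v) w v.
Proof.
move=> esym SP IS XE; have XI v : X v -> I v by rewrite XE => /andP[].
rewrite (bigID X) /= mulr2n mulrDl mul1r lerD //.
  by rewrite (eq_bigl X) // => v; rewrite andbC; case Xv : (X v) => //=; exact: XI.
apply: (@le_trans _ _ (\sum_(u | X u) \sum_(v | [&& e u v, (r v < r u)%N & S v]) w v)); last first.
  by apply: ler_sum => u /XI /IS /SP.
rewrite big_mkcond.
under [leRHS]eq_bigr => u _ do rewrite big_mkcond.
rewrite exchange_big /=; apply: ler_sum => v _.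
case: ifP => [/andP[Iv]|_]; last by apply: sumr_ge0 => u _; case: ifP.
rewrite XE Iv /= negbK => /existsP[u /and3P[vu ruv Xu]].
by rewrite (bigD1 u) //= esym vu ruv (IS _ Iv) /= ler_wpDr // sumr_ge0 // => i _; case: ifP.
Qed.

End Greedy.

(** * Greedy sweeps as distributed algorithms *)

Section Sweeps.
Variable R : realType.

(* The Boolean paired with a neighbour's weight tells whether the next sweep
   takes this neighbour into account. *)
Record node := Node {
  wt : R; key1 : nat; key2 : nat; sel : bool; nbrs : seq (bool * R) }.

(** A neighbour that has not spoken yet counts as unselected. *)
Definition heard (o : option (nat * bool)) : bool := if o is Some (_, b) then b else false.

Definition forward_dec (x : node) (h : seq (option (nat * bool))) : bool :=
  sel x && (\sum_(p <- zip (nbrs x) h | p.1.1 && heard p.2) p.1.2 <= wt x).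

Definition backward_dec (x : node) (h : seq (option (nat * bool))) : bool :=
  sel x && ~~ has (fun p => p.1.1 && heard p.2) (zip (nbrs x) h).

Definition sweep_post (mk : node -> bool -> nat -> bool) (x : node) (b : bool)
    (nbs : seq (nat * bool)) : node :=
  Node (wt x) (key1 x) (key2 x) b
    [seq (mk x p.1.1 p.2.1, p.1.2) | p <- zip (nbrs x) nbs].

Variables (N : network) (par B T : nat) (w : N -> R) (k1 k2 : N -> nat).

Definition info (s : N -> bool) (mk : rel N) (v : N) : node :=
  Node (w v) (k1 v) (k2 v) (s v) [seq (mk v u, w u) | u <- ports v].

Variables (Y : Type) (key : node -> nat) (upd : node -> bool -> nat -> bool).
Variables (fin : node -> Y) (s : N -> bool) (mk : rel N).
Let x := info s mk.
Hypotheses (B_gt0 : (0 < B)%N) (keyT : forall v, (key (x v) < T)%N).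

Let post_info (s' : N -> bool) v :
  sweep_post upd (x v) (s' v) [seq (key (x u), s' u) | u <- ports v] =
  info s' (fun v u => upd (x v) (mk v u) (key (x u))) v.
Proof.
by rewrite /sweep_post /info /= zip_map -map_comp.
Qed.

Lemma runs_forward : exists2 s' : N -> bool,
    forall v, s' v = s v && (\sum_(u | [&& adj N v u && mk v u,
                                (key (x u) < key (x v))%N & s' u]) w u <= w v)
  & runs (sweep key forward_dec (fun z b nbs => fin (sweep_post upd z b nbs))) par B T x
      (fun v => fin (info s' (fun v u => upd (x v) (mk v u) (key (x u))) v)).
Proof.
have [s' s'E run] := @runs_sweep _ _ key forward_dec
  (fun z b nbs => fin (sweep_post upd z b nbs)) N par B T x B_gt0 keyT.
exists s' => [v|]; last first.
  by have [mb out] := run; split=> // v; rewrite out post_info.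
rewrite s'E /forward_dec /=; congr (_ && (_ <= _)).
rewrite zip_map big_map big_mkcond big_uniq ?ports_uniq //= -big_mkcondr /=.
apply: eq_bigl => u; rewrite portsE -andbA; congr (_ && (_ && _)).
by case: ifP.
Qed.

Lemma runs_backward : exists2 s' : N -> bool,
    forall v, s' v = s v && ~~ [exists u, [&& adj N v u && mk v u,
                                (key (x u) < key (x v))%N & s' u]]
  & runs (sweep key backward_dec (fun z b nbs => fin (sweep_post upd z b nbs))) par B T x
      (fun v => fin (info s' (fun v u => upd (x v) (mk v u) (key (x u))) v)).
Proof.
have [s' s'E run] := @runs_sweep _ _ key backward_dec
  (fun z b nbs => fin (sweep_post upd z b nbs)) N par B T x B_gt0 keyT.
exists s' => [v|]; last first.
  by have [mb out] := run; split=> // v; rewrite out post_info.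
rewrite s'E /backward_dec /=; congr (_ && ~~ _).
rewrite zip_map has_map; apply/hasP/existsP => -[u].
  rewrite portsE => vu /= /andP[muv]; case: ifP => //= kuv su.
  by exists u; rewrite vu muv kuv su.
case/and3P => /andP[vu muv] kuv su; exists u; first by rewrite portsE.
by rewrite /= muv kuv su.
Qed.

End Sweeps.

(** * The four sweeps *)

Section FourSweeps.
Variables (R : realType) (S d L k m : nat) (dec : bitseq -> R).
Variables (Acol : algorithm unit nat) (Tc : nat).

(* Layers are cut into k sublayers of m colours each: [key1] numbers the
   sublayers of all layers from bottom to top, [key2] the colours inside. *)
Definition layered_node (z : R * seq R * nat * bitseq) (c : nat) : node R :=
  Node z.1.1.1 (z.1.2 * k + c %/ m)%N (c %% m)%N true
    [seq (true, u) | u <- z.1.1.2].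

(** Backward sweeps complement the key to reverse the order. As for the flags, [forward1] marks the
    neighbours in the same sublayer, [forward2] keeps the marks, and [backward2] marks everyone
    again for [backward1]. *)
Definition backward1 : algorithm (node R) bool :=
  sweep (fun x => (L * k).-1 - key1 x)%N (@backward_dec R)
    (fun z b nbs => sel (sweep_post (fun _ _ _ => true) z b nbs)).

Definition backward2 : algorithm (node R) (node R) :=
  sweep (fun x => m.-1 - key2 x)%N (@backward_dec R)
    (sweep_post (fun _ _ _ => true)).

Definition forward2 : algorithm (node R) (node R) :=
  sweep (@key2 R) (@forward_dec R) (sweep_post (fun _ o _ => o)).

Definition forward1 : algorithm (node R) (node R) :=
  sweep (@key1 R) (@forward_dec R) (sweep_post (fun x _ t => t == key1 x)).

Definition four_sweeps : algorithm R bool :=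
  run_then (exchange dec S) S
  (run_then (peel d (fun (z : R * seq R) lay lays => (z, lay, [seq lay == l | l <- lays]))) L
  (run_then (on_subnetwork Acol d snd layered_node) Tc
  (run_then forward1 (L * k)
  (run_then forward2 m
  (run_then backward2 m backward1))))).

Variables (N : network) (par B M : nat) (w : N -> R).
Hypotheses (B_gt0 : (0 < B)%N) (m_gt0 : (0 < m)%N) (M_le : (M <= k * m)%N).
Hypothesis w_ge0 : forall v, 0 <= w v.
Hypothesis w_code : forall v, exists s : bitseq, (size s <= S)%N /\ dec s = w v.
Hypothesis alive0 : alive d N L = finset.set0.
Hypothesis colors : forall lay : N -> nat,
  (forall v, #|[set u | adj N v u && (lay v == lay u)]| <= d)%N ->
  exists y : N -> nat, [/\ @runs _ _ Acol (sub_network lay) d B Tc (fun=> tt) y,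
    forall v, (y v < M)%N
  & forall u v, sub_adj lay u v -> y u != y v].

Lemma runs_four_sweeps : exists X : N -> bool,
  [/\ runs four_sweeps par B (S + (L + (Tc + (L * k + (m + (m + L * k)))))) w X,
      independent [set v | X v]
    & \sum_v w v <= 4 * d.+1%:R ^+ 2 * \sum_(v | X v) w v].
Proof.
have [lay layP runH] := @runs_peel _ _ d
  (fun (z : R * seq R) lay lays => (z, lay, [seq lay == l | l <- lays])) N par B L
  (fun v => (w v, [seq w u | u <- ports v])) B_gt0 alive0.
have same_lay v : (#|[set u | adj N v u && (lay v == lay u)]| <= d)%N.
  apply: leq_trans (layP v).2; apply: subset_leq_card; apply/fintype.subsetP => u.
  by rewrite !inE => /andP[-> /eqP->] /=.
have [c [runAcol cM cP]] := colors same_lay.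
pose z0 v := (w v, [seq w u | u <- ports v], lay v,
              [seq lay v == l | l <- [seq lay u | u <- ports v]]).
have maskE v : (z0 v).2 = [seq lay v == lay u | u <- ports v] by rewrite /z0 -map_comp.
have runC := @runs_on_subnetwork _ _ Acol d snd layered_node N lay par B Tc z0 maskE c runAcol.
pose k1 v := (lay v * k + c v %/ m)%N; pose k2 v := (c v %% m)%N.
have ltk v : (c v %/ m < k)%N by rewrite ltn_divLR // (leq_trans (cM v)).
have k1T v : (k1 v < L * k)%N.
  have := (layP v).1; have := ltk v; rewrite /k1; move: (c v %/ m)%N => q.
  nia.
have k2T v : (k2 v < m)%N by rewrite ltn_pmod.
(* Sublayers are numbered layer by layer, so the degree bound of the peeling applies to the order of
   [k1]. *)
have k1_lay u v : (k1 u <= k1 v)%N -> (lay u <= lay v)%N.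
  rewrite leqNgt [in X in _ -> X]leqNgt; apply: contra => ltl.
  have := ltk u; have := ltk v; rewrite /k1; move: (c v %/ m)%N (c u %/ m)%N => q q'.
  nia.
(* In one sublayer the layers and the quotients [c %/ m] agree, so adjacent nodes differ in the
   remainder. *)
have k12 u v : adj N u v -> k1 u = k1 v -> k2 u != k2 v.
  move=> uv k1E; have layE : lay u = lay v.
    by apply/eqP; rewrite eqn_leq !k1_lay ?k1E.
  have := cP u v; rewrite /sub_adj uv layE eqxx => /(_ isT); apply: contraNneq => k2E.
  rewrite (divn_eq (c u) m) (divn_eq (c v) m); apply/eqP; congr (_ * _ + _)%N => //.
  by move: k1E; rewrite /k1 layE => /addnI.
pose all_nbrs : rel N := fun _ _ => true.
have [s1 s1E runF1] := @runs_forward R N par B (L * k) w k1 k2 (node R) (@key1 R)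
  (fun x _ t => t == key1 x) id xpredT all_nbrs B_gt0 k1T.
pose same : rel N := fun v u => k1 u == k1 v.
have [s2 s2E runF2] := @runs_forward R N par B m w k1 k2 (node R) (@key2 R)
  (fun _ o _ => o) id s1 same B_gt0 k2T.
have k2T' v : (m.-1 - k2 v < m)%N by rewrite -subSn; move: (k2T v); lia.
have [s3 s3E runB2] := @runs_backward R N par B m w k1 k2 (node R) (fun x => m.-1 - key2 x)%N
  (fun _ _ _ => true) id s2 same B_gt0 k2T'.
have k1T' v : ((L * k).-1 - k1 v < L * k)%N by move: (k1T v); lia.
have [X XE runB1] := @runs_backward R N par B (L * k) w k1 k2 bool
  (fun x => (L * k).-1 - key1 x)%N (fun _ _ _ => true) (@sel R) s3 all_nbrs B_gt0 k1T'.
have infoE : (fun v => layered_node (z0 v) (c v)) = info w k1 k2 xpredT all_nbrs.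
  by apply/funext => v; rewrite /layered_node /info /= -map_comp.
rewrite infoE in runC.
have same_sym : symmetric (fun u v => adj N u v && same u v).
  by move=> u v; rewrite adj_sym /same [k1 u == _]eq_sym.
have {}s1E v : s1 v = (\sum_(u | [&& adj N v u, (k1 u < k1 v)%N & s1 u]) w u <= w v).
  by rewrite s1E /=; congr (_ <= _); apply: eq_bigl => u; rewrite andbT.
have {}s2E v : s2 v = s1 v &&
    (\sum_(u | [&& adj N v u && same v u, (k2 u < k2 v)%N & s2 u]) w u <= w v).
  by rewrite s2E; congr (_ && (_ <= _)); apply: eq_bigl => u; rewrite /= [k1 u == _]eq_sym.
have {}s3E v : s3 v = s2 v &&
    ~~ [exists u, [&& adj N v u && same v u, (k2 v < k2 u)%N & s3 u]].
  rewrite s3E /=; congr (_ && ~~ _); apply: eq_existsb => u.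
  by congr [&& _ && _, _ & _]; move: (k2T u) (k2T v); lia.
have {}XE v : X v = s3 v && ~~ [exists u, [&& adj N v u, (k1 v < k1 u)%N & X u]].
  rewrite XE /=; congr (_ && ~~ _); apply: eq_existsb => u; rewrite andbT.
  by congr [&& _, _ & _]; move: (k1T u) (k1T v); lia.
exists X; split.
- apply: runs_then; first exact: runs_exchange.
  apply: runs_then; first exact: runH.
  apply: runs_then; first exact: runC.
  apply: runs_then; first exact: runF1.
  apply: runs_then; first exact: runF2.
  apply: runs_then; first exact: runB2.
  exact: runB1.
(* Adjacent kept nodes have equal keys. The outer backward sweep thus puts them into one sublayer,
   and the inner one then forces equal [k2], against [k12]. *)
- have block (P Q : pred N) (e : rel N) (r : N -> nat) :
      (forall v, P v = Q v && ~~ [exists u, [&& e v u, (r v < r u)%N & P u]]) ->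
      forall u v, e u v -> P u -> P v -> (r v <= r u)%N.
    move=> PE u v uv; rewrite PE => /andP[_ /existsPn noP] Pv.
    by have := noP v; rewrite uv Pv andbT /= -leqNgt.
  apply/fintype.forallP => u; apply/implyP; rewrite inE => Xu.
  apply/fintype.forallP => v; apply/implyP; rewrite inE => Xv; apply/negP => uv.
  have vu : adj N v u by rewrite adj_sym.
  have k1E : k1 u = k1 v.
    by apply/eqP; rewrite eqn_leq !(block X s3 (adj N) k1 XE).
  have [s3u s3v] : s3 u /\ s3 v by move: Xu Xv; rewrite !XE => /andP[-> _] /andP[-> _].
  have := k12 _ _ uv k1E; rewrite eqn_leq.
  have blockS a b : adj N a b -> k1 a = k1 b -> s3 a -> s3 b -> (k2 b <= k2 a)%N.
    by move=> ab abE; apply: (block s3 s2 _ k2 s3E); rewrite ab /same abE eqxx.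
  by rewrite !blockS.
have W1 : \sum_v w v <= d.+1%:R * \sum_(v | s1 v) w v.
  apply: (@forward_greedy _ _ (adj N) k1 w w_ge0 d xpredT s1) => // u.
  apply: leq_trans (layP u).2; apply: subset_leq_card; apply/fintype.subsetP => v.
  by rewrite !inE [adj N v u]adj_sym => /andP[-> /ltnW /k1_lay].
have W2 : \sum_(v | s1 v) w v <= d.+1%:R * \sum_(v | s2 v) w v.
  apply: (@forward_greedy _ _ (fun u v => adj N u v && same u v) k2 w w_ge0 d s1 s2) => // u.
  apply: leq_trans (layP u).2; apply: subset_leq_card; apply/fintype.subsetP => v.
  by rewrite !inE [adj N v u]adj_sym => /andP[/andP[-> /eqP k1E] _]; rewrite k1_lay ?k1E.
have W3 : \sum_(v | s2 v) w v <= 2 * \sum_(v | s3 v) w v.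
  apply: (@backward_greedy _ _ (fun u v => adj N u v && same u v) k2 w w_ge0 s2 s2 s3) => //.
  by move=> v; rewrite s2E => /andP[].
(* The outer invariant holds for [s1], which contains [s3]. *)
have W4 : \sum_(v | s3 v) w v <= 2 * \sum_(v | X v) w v.
  apply: (@backward_greedy _ _ (adj N) k1 w w_ge0 s1 s3 X) => //.
  - exact: adj_sym.
  - by move=> v; rewrite s1E.
  - by move=> v; rewrite s3E s2E => /andP[/andP[]].
have -> : 4 * d.+1%:R ^+ 2 * \sum_(v | X v) w v =
    d.+1%:R * (d.+1%:R * (2 * (2 * \sum_(v | X v) w v))) :> R by ring.
apply: le_trans W1 _; rewrite ler_wpM2l //.
apply: le_trans W2 _; rewrite ler_wpM2l //.
by apply: le_trans W3 _; rewrite ler_wpM2l.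
Qed.

End FourSweeps.

(** * Choice of the parameters *)

Section Dispatch.
Variables (X Y : Type) (A : nat * nat -> algorithm X Y).

(** One algorithm for all networks: every node knows n and the parameter, and picks the same member
    of the family. The pair is kept since the state type depends on it. *)
Definition dispatch : algorithm X Y := {|
  state := {p : nat * nat & state (A p)};
  init := fun i => existT (fun p => state (A p)) (known_n i, known_par i) (init (A _) i);
  send := fun s => send (projT2 s);
  recv := fun s ms => existT (fun p => state (A p)) (projT1 s) (recv (projT2 s) ms);
  output := fun s => output (projT2 s) |}.

Lemma runs_dispatch (N : network) (par B T : nat) (x : N -> X) (y : N -> Y) :
  runs (A (#|N|, par)) par B T x y -> runs dispatch par B T x y.
Proof.
have st t v : state_after dispatch par x t v =
    existT (fun p => state (A p)) (#|N|, par) (state_after (A (#|N|, par)) par x t v).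
  elim: t v => [//|t IH] v /=; rewrite IH /=.
  by under eq_map => u do rewrite IH.
move=> [mb out]; split=> [t u v tT uv|v]; last by rewrite /output_after st -out.
by rewrite st; exact: mb.
Qed.

End Dispatch.

Definition map_output (X Y Y' : Type) (f : Y -> Y') (A : algorithm X Y) : algorithm X Y' :=
  {| state := state A; init := @init _ _ A; send := @send _ _ A; recv := @recv _ _ A;
     output := fun s => f (output s) |}.

Lemma state_map_output (X Y Y' : Type) (f : Y -> Y') (A : algorithm X Y) (N : network)
    (par : nat) (x : N -> X) t v :
  state_after (map_output f A) par x t v = state_after A par x t v.
Proof. by elim: t v => //= t IH v; congr recv; apply/eq_map => u; rewrite IH. Qed.

Definition own_ident_algorithm : algorithm unit nat :=
  {| state := nat; init := fun i => own_ident i; send := fun _ _ => [::];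
     recv := fun s _ => s; output := id |}.

Definition colors_with (cId B n d : nat) (A : algorithm unit nat) (T M : nat) : Prop :=
  forall N : network, #|N| = n -> short_idents cId N -> max_degree_le N d ->
  exists y : N -> nat, [/\ runs A d B T (fun=> tt) y, forall v, (y v < M)%N
    & forall u v, adj N u v -> y u != y v].

(* If no number of rounds suffices for a (d+1)-coloring, then the bound to be
   proved is +oo and the identifiers can serve as colors. *)
Lemma COL_colors (R : realType) (cId cMsg n d : nat) : exists A T M,
  colors_with cId (cMsg * nbits n) n d A T M /\
  (COL R cId cMsg n d = +oo%E \/ M = d.+1 /\ (T%:R%:E <= COL R cId cMsg n d)%E).
Proof.
have [exT|noT] := pselect (exists T, coloring_in cId cMsg n d T); last first.
  exists own_ident_algorithm, 0%N, (2 ^ (cId * nbits n))%N; split=> [N Nn idN _|].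
    exists (@ident N); split=> [|v|u v uv]; first by split.
      by have := idN v; rewrite Nn.
    by apply: contraTneq uv => /ident_inj->; rewrite adj_irr.
  left; rewrite /COL (_ : [set T | _]%classic = set0) ?image_set0 ?ereal_inf0 //.
  by apply/seteqP; split=> // T colT; apply: noT; exists T.
have exT' : exists T, `[< coloring_in cId cMsg n d T >].
  by have [T colT] := exT; exists T; apply/asboolP.
(* The least such [T] attains the infimum in [COL]. *)
have [T /asboolP [A colA] minT] := ex_minnP exT'.
exists (map_output (@nat_of_ord _) A), T, d.+1; split=> [N Nn idN degN|]; last first.
  right; split=> //; apply: le_ereal_inf_tmp => _ [T' /= colT' <-].
  by rewrite lee_fin ler_nat; apply: minT; apply/asboolP.
have [mb proper] := colA N Nn idN degN.
exists (fun v => output_after A d (fun=> tt) T v); split=> [|v|u v uv].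
- split=> [t u v tT uv|v]; last by rewrite /output_after state_map_output.
  by rewrite state_map_output; exact: mb.
- exact: ltn_ord.
- exact: proper.
Qed.

(** * Numeric estimates for layers, sublayers and logarithms *)

Section NumericBounds.
Variable R : realType.

Lemma bernoulli (x : R) (k : nat) : 0 <= x -> 1 + k%:R * x <= (1 + x) ^+ k.
Proof.
move=> x0; elim: k => [|k IH]; first by rewrite mul0r addr0 expr0.
rewrite exprS; apply: le_trans (ler_wpM2l _ IH); last by rewrite addr_ge0.
have : 0 <= k%:R * x * x by rewrite !mulr_ge0.
by rewrite -natr1; lra.
Qed.

(** As [d.+1] exceeds [(2 + eps) * alpha], a round shrinks the alive set by the factor
    [1 + eps / 2]. So [K] rounds halve it, and after [nbits n] halvings less than one node is
    left. *)
Lemma alive_empty (eps : R) (K : nat) (N : network) (alpha : nat) : 0 < eps ->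
    2 <= (1 + eps / 2) ^+ K -> forest_partition N alpha ->
  alive (Num.truncn ((2 + eps) * alpha%:R)) N (K * nbits #|N|) = finset.set0.
Proof.
move=> eps0 K2 fp; set d := Num.truncn _; set rho := 1 + eps / 2.
have rho0 : 0 < rho by rewrite /rho; lra.
have cardE t : rho ^+ t * #|alive d N t|%:R <= #|N|%:R.
  elim: t => [|t IH]; first by rewrite expr0 mul1r cardsT.
  apply: le_trans IH; rewrite exprSr -mulrA; apply: ler_wpM2l; first by rewrite ltW // exprn_gt0.
  have := alive_card d t fp; rewrite -(ler_nat R) !natrM => le.
  have dlt : (2 + eps) * alpha%:R < d.+1%:R :> R by rewrite truncnS_gt.
  (* For [alpha = 0] one cannot divide by [alpha], but [le] already shows that no node survives. *)
  case: (posnP alpha) => [a0|a0].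
    move: le; rewrite a0 mulr0 mul0r pmulr_rle0 ?ltr0n //.
    by rewrite lern0 => /eqP ->; rewrite mulr0.
  have a0' : 0 < alpha%:R :> R by rewrite ltr0n.
  have : (2 + eps) * alpha%:R * #|alive d N t.+1|%:R <= 2 * alpha%:R * #|alive d N t|%:R.
    by apply: le_trans le; rewrite ler_wpM2r // ltW.
  rewrite (_ : (2 + eps) * alpha%:R * _ = (2 * alpha%:R) * (rho * #|alive d N t.+1|%:R)); last first.
    by rewrite /rho; field.
  by rewrite ler_pM2l // mulr_gt0.
apply/eqP; rewrite -cards_eq0 -leqn0 -ltnS -(ltr_nat R).
have n_lt : #|N|%:R < 2 ^+ nbits #|N| :> R.
  by rewrite -natrX ltr_nat trunc_log_ltn.
have := cardE (K * nbits #|N|)%N; rewrite exprM => le.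
rewrite -(ltr_pM2l (exprn_gt0 (nbits #|N|) (exprn_gt0 K rho0))) mulr1.
apply: le_lt_trans le _; apply: lt_le_trans n_lt _.
by apply: lerXn2r => //; rewrite nnegrE ?exprn_ge0 // ltW.
Qed.

(** With [m] about [sqrt (M * b)], the [b * (m %/ b).+1] sublayers and the [m] colors inside them
    balance. *)
Definition width (M b : nat) : nat := (Num.truncn (Num.sqrt (M * b)%:R : R)).+1.

Lemma width_cover (M b : nat) : (0 < b)%N ->
  (M <= (width M b %/ b).+1 * width M b)%N.
Proof.
move=> b0; have : (M * b <= width M b * width M b)%N.
  rewrite -(ler_nat R) [leRHS]natrM -expr2 -[leLHS]sqr_sqrtr //.
  by rewrite lerXn2r ?nnegrE ?sqrtr_ge0 // ltW // truncnS_gt.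
have := ltn_ceil (width M b) b0; move: (width M b) (width M b %/ b)%N => q c.
by nia.
Qed.

(** For [n >= 2] the logarithm [trunc_log 2 n] is at least 1, so doubling it absorbs the successor
    in [nbits]. *)
Lemma nbits_le_ln (n : nat) : (1 < n)%N -> (nbits n)%:R <= 2 / ln 2 * ln n%:R :> R.
Proof.
move=> n1; have ln2 : 0 < ln 2 :> R by rewrite ln_gt0 // ltr1n.
rewrite mulrAC ler_pdivlMr //.
have : (2 ^ trunc_log 2 n <= n)%N by rewrite trunc_logP // ltnW.
rewrite -(ler_nat R) -ler_ln ?posrE ?ltr0n ?expn_gt0 // ?(ltnW n1) //.
rewrite natrX lnXn // -[ln 2 *+ _]mulr_natr => le.
have : (nbits n)%:R <= 2 * (trunc_log 2 n)%:R :> R.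
  have : (0 < trunc_log 2 n)%N by apply: trunc_log_max; rewrite ?expn1.
  by rewrite -natrM ler_nat /nbits; lia.
move=> nb; apply: le_trans (ler_wpM2r (ltW ln2) nb) _.
by rewrite -mulrA ler_pM2l // mulrC.
Qed.

End NumericBounds.

Lemma OPT_le_total (R : realType) (G : sgraph) (w : G -> R) : (forall v, 0 <= w v) ->
  OPT w <= \sum_v w v.
Proof.
move=> w0; apply: bigmax_le => [|I _]; first by apply: sumr_ge0.
by rewrite /weight [leRHS](bigID (mem I)) /= lerDl sumr_ge0.
Qed.

Lemma total_approximation (R : realType) (G : sgraph) (w : G -> R) (q : R) (X : {set G}) :
    (forall v, 0 <= w v) -> independent X -> \sum_v w v <= q * weight w X ->
  is_approximation w q X.
Proof. by move=> w0 indX le; split=> //; exact: le_trans (OPT_le_total w0) le. Qed.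

(** Serves [n <= 1], where the logarithmic terms of the round bound vanish and zero rounds are
    used. *)
Definition take_all (X : Type) : algorithm X bool :=
  {| state := unit; init := fun _ => tt; send := fun _ _ => [::];
     recv := fun s _ => s; output := fun _ => true |}.

(** * Approximation ratio and round count for fixed n and [alpha] *)

Section FixedParameters.
Variables (R : realType) (eps : R) (cId cMsg cW K : nat).
Hypotheses (eps_gt0 : 0 < eps) (cMsg_gt0 : (0 < cMsg)%N).
Hypothesis K_ge2 : 2 <= (1 + eps / 2) ^+ K.

Let c : R := 2 / ln 2.
Let s : R := Num.sqrt ((2 + eps) * c).
Definition ratio_const : R := 4 * (3 + eps) ^+ 2.
(** The 1 pays for the coloring. Inserting [width_le] into [(cW + 3 * K) * b + (2 * K + 2) * m]
    gives [3 * K + 2 * (2 * K + 2) = 7 * K + 4]. *)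
Definition round_const : R := 1 + (cW + 7 * K + 4)%:R * c + (2 * K + 2)%:R * s.

Let c_ge0 : 0 <= c.
Proof. by rewrite divr_ge0 // ln_ge0 // ler1n. Qed.

Let s_ge0 : 0 <= s. Proof. exact: sqrtr_ge0. Qed.

Lemma round_const_ge1 : 1 <= round_const.
Proof. by rewrite /round_const -addrA lerDl addr_ge0 // mulr_ge0. Qed.

Definition degree_bound (alpha : nat) : nat := Num.truncn ((2 + eps) * alpha%:R).

Lemma degree_bound_le alpha : (degree_bound alpha)%:R <= (2 + eps) * alpha%:R :> R.
Proof. by rewrite truncn_le // mulr_ge0 // addr_ge0 // ltW. Qed.

Lemma ratio_bound alpha :
  4 * (degree_bound alpha).+1%:R ^+ 2 <= ratio_const * (maxn 1 alpha ^ 2)%:R.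
Proof.
rewrite /ratio_const natrX -mulrA -exprMn ler_pM2l //.
have le1 : 1 <= (maxn 1 alpha)%:R :> R by rewrite ler1n leq_maxl.
have lea : alpha%:R <= (maxn 1 alpha)%:R :> R by rewrite ler_nat leq_maxr.
have lex : (2 + eps) * alpha%:R <= (2 + eps) * (maxn 1 alpha)%:R.
  by rewrite ler_wpM2l // addr_ge0 // ltW.
have le3 : (degree_bound alpha).+1%:R <= (3 + eps) * (maxn 1 alpha)%:R.
  by rewrite -natr1; have := degree_bound_le alpha; lra.
by rewrite lerXn2r // nnegrE // (le_trans _ le3).
Qed.

(** Let [y] be the first summand and [b = nbits n]. Then [(d + 1) * b <= y ^ 2 + b <= (y + b) ^ 2],
    and the successor in [width] costs at most another [b]. *)
Lemma width_le n alpha : (1 < n)%N ->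
  (width R (degree_bound alpha).+1 (nbits n))%:R <=
  s * Num.sqrt (alpha%:R * ln n%:R) + 2 * (nbits n)%:R.
Proof.
move=> n1; have b1 : 1 <= (nbits n)%:R :> R by rewrite ler1n.
have lnn : 0 <= ln n%:R :> R by rewrite ln_ge0 // ler1n ltnW.
have bc := nbits_le_ln R n1; rewrite -/c in bc.
have q_le : (width R (degree_bound alpha).+1 (nbits n))%:R <=
    Num.sqrt ((degree_bound alpha).+1 * nbits n)%:R + 1 :> R.
  by rewrite /width -natr1 lerD2r truncn_le sqrtr_ge0.
apply: le_trans q_le _.
have y0 : 0 <= s * Num.sqrt (alpha%:R * ln n%:R) by rewrite mulr_ge0 ?sqrtr_ge0.
suff: Num.sqrt ((degree_bound alpha).+1 * nbits n)%:R <=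
    s * Num.sqrt (alpha%:R * ln n%:R) + (nbits n)%:R :> R by lra.
set y := s * _ in y0 *; have y2 : y ^+ 2 = (2 + eps) * (alpha%:R * (c * ln n%:R)).
  rewrite exprMn !sqr_sqrtr; first by ring.
    by rewrite mulr_ge0.
  by rewrite mulr_ge0 // addr_ge0 // ltW.
have yb0 : 0 <= y + (nbits n)%:R by rewrite addr_ge0.
rewrite -[leRHS]ger0_norm // -sqrtr_sqr ler_wsqrtr // natrM -natr1.
have : (degree_bound alpha)%:R * (nbits n)%:R <= y ^+ 2.
  apply: le_trans (ler_wpM2r _ (degree_bound_le alpha)) _ => //.
  rewrite y2 -[leLHS]mulrA ler_wpM2l //; first by rewrite addr_ge0 // ltW.
  by rewrite ler_wpM2l.
have : (nbits n)%:R <= (nbits n)%:R ^+ 2 :> R by rewrite expr2 ler_peMl.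
have : 0 <= y * (nbits n)%:R by rewrite mulr_ge0.
by rewrite sqrrD; lra.
Qed.

Definition rounds (n Tc M : nat) : nat :=
  let b := nbits n in let m := width R M b in let L := (K * b)%N in
  let k := (m %/ b).+1 in
  (cW * b + (L + (Tc + (L * k + (m + (m + L * k))))))%N.

Lemma rounds_le n alpha (Tc : nat) : (1 < n)%N ->
  (rounds n Tc (degree_bound alpha).+1)%:R <=
    round_const * (ln n%:R + Tc%:R + Num.sqrt (alpha%:R * ln n%:R)).
Proof.
move=> n1; rewrite /rounds; set b := nbits n; set m := width R _ b.
have lnn : 0 <= ln n%:R :> R by rewrite ln_ge0 // ler1n ltnW.
have bc : b%:R <= c * ln n%:R := nbits_le_ln R n1.
have mle := width_le alpha n1; rewrite -/b -/m in mle.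
(* Each outer sweep takes [K * b * (m %/ b).+1 <= K * (m + b)] rounds. *)
set t := (_ + _)%N; have : (t <= (cW + 3 * K) * b + (2 * K + 2) * m + Tc)%N.
  have := leq_trunc_div m b; rewrite /t; move: (m %/ b)%N => k; nia.
rewrite -(ler_nat R) !natrD !natrM => le; apply: le_trans le _.
set r := Num.sqrt _ in mle *; have r0 : 0 <= r by exact: sqrtr_ge0.
pose P : R := (cW + 7 * K + 4)%:R; pose Q : R := (2 * K + 2)%:R.
have -> : round_const = 1 + P * c + Q * s by [].
apply: (@le_trans _ _ (P * b%:R + Q * (s * r) + Tc%:R)).
  have := ler_wpM2l (ler0n R (2 * K + 2)) mle; rewrite /P /Q !natrD.
  by lra.
have P0 : 0 <= P by []. have Q0 : 0 <= Q by [].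
have := ler_wpM2l P0 bc.
have : 0 <= P * c * (Tc%:R + r) by apply: mulr_ge0; [exact: mulr_ge0|exact: addr_ge0].
have : 0 <= Q * s * (ln n%:R + Tc%:R) by apply: mulr_ge0; [exact: mulr_ge0|exact: addr_ge0].
by lra.
Qed.

Lemma algorithm_for_parameters (dec : bitseq -> R) (n alpha : nat) : exists AT : algorithm R bool * nat,
  forall (N : network) (w : N -> R), #|N| = n ->
    short_idents cId N -> forest_partition N alpha -> (forall v, 0 <= w v) ->
    (forall v, exists t : bitseq, (size t <= cW * nbits n)%N /\ dec t = w v) ->
    (exists2 X : N -> bool, runs AT.1 alpha (cMsg * nbits n) AT.2 w X
      & is_approximation w (ratio_const * (maxn 1 alpha ^ 2)%:R) [set v | X v]) /\
    (AT.2%:R%:E <= round_const%:E * ((ln n%:R)%:E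
       + COL R cId cMsg n (degree_bound alpha)
       + (Num.sqrt (alpha%:R * ln n%:R))%:E))%E.
Proof.
have [n1|n1] := leqP n 1.
  exists (take_all R, 0%N) => N w Nn _ _ w0 _; split; last first.
    rewrite mule_ge0 ?lee_fin ?(le_trans _ round_const_ge1) //.
    rewrite !adde_ge0 ?lee_fin ?sqrtr_ge0 //.
      by case: n n1 {Nn} => [|[]] // _; rewrite ?ln1 ?ln0.
    by apply: le_ereal_inf_tmp => _ [T _ <-]; rewrite lee_fin.
  exists (fun=> true); first by split.
  have /fintype_le1P all1 : (#|N| <= 1)%N by rewrite Nn.
  apply: total_approximation => //.
    apply/fintype.forallP => u; apply/implyP => _; apply/fintype.forallP => v; apply/implyP => _.
    by rewrite (all1 v u) adj_irr.
  have -> : weight w [set _ | true] = \sum_v w v by apply: eq_bigl => v; rewrite inE.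
  rewrite ler_peMl ?sumr_ge0 //; apply: le_trans (ratio_bound alpha).
  by rewrite -natrX -natrM ler1n muln_gt0 expn_gt0.
pose d := degree_bound alpha; pose b := nbits n.
have [A [Tc [M [colA COLE]]]] := COL_colors R cId cMsg n d.
pose m := width R M b; pose k := (m %/ b).+1.
exists (four_sweeps (cW * b) d (K * b) k m dec A Tc, rounds n Tc M).
move=> N w Nn idN fp w0 repr; split.
  have B0 : (0 < cMsg * b)%N by rewrite muln_gt0 cMsg_gt0.
  have [||X [runX indX leX]] := @runs_four_sweeps R (cW * b) d (K * b) k m dec A Tc N alpha (cMsg * b) M w
    B0 (ltn0Sn _) (width_cover R M (ltn0Sn _)) w0 repr.
  - by rewrite /b -Nn; exact: alive_empty.
  - by move=> lay degN; exact: colA (sub_network lay) Nn idN degN.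
  exists X => //; apply: total_approximation => //.
  apply: le_trans leX _.
  have -> : weight w [set v | X v] = \sum_(v | X v) w v by apply: eq_bigl => v; rewrite inE.
  by rewrite ler_wpM2r ?sumr_ge0 // ratio_bound.
have lnn : 0 <= ln n%:R :> R by rewrite ln_ge0 // ler1n ltnW.
(* An infinite [COL] makes the bound trivial, as [round_const] is positive. *)
case: COLE => [->|[ME leCOL]].
  rewrite addey // addye // gt0_muley ?leey // lte_fin.
  exact: lt_le_trans round_const_ge1.
apply: le_trans (_ : _ <= round_const%:E * ((ln n%:R)%:E + Tc%:R%:E
    + (Num.sqrt (alpha%:R * ln n%:R))%:E))%E _.
  by rewrite -!EFinD -EFinM lee_fin ME; exact: rounds_le.
rewrite lee_wpmul2l ?lee_fin ?(le_trans _ round_const_ge1) //.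
by rewrite leeD2r // leeD2l.
Qed.

End FixedParameters.

Theorem theorem4p2 (R : realType) (eps : R) (eps_gt0 : 0 < eps)
    (cId cMsg cW : nat) (cMsg_gt0 : (0 < cMsg)%N) :
  exists Cq Cr : R, [/\ 0 < Cq, 0 < Cr &
  forall dec : nat -> bitseq -> R,
  exists (A : algorithm R bool) (T : nat -> nat -> nat),
  forall (N : network) (alpha : nat) (w : N -> R),
    short_idents cId N ->
    is_arboricity N alpha ->
    (forall v, 0 <= w v) ->
    (forall v, representable dec #|N| (cW * nbits #|N|) (w v)) ->
    [/\ messages_bounded A alpha w (cMsg * nbits #|N|) (T #|N| alpha),
        is_approximation w (Cq * (maxn 1 alpha ^ 2)%:R)
          [set v | output_after A alpha w (T #|N| alpha) v]
      & ((T #|N| alpha)%:R%:E <=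
         Cr%:E * ((ln #|N|%:R)%:E
                  + COL R cId cMsg #|N| (Num.truncn ((2 + eps) * alpha%:R))
                  + (Num.sqrt (alpha%:R * ln #|N|%:R))%:E))%E]].
Proof.
(* By Bernoulli it suffices that [K * eps / 2 >= 1]. *)
have [K K_ge2] : exists K, 2 <= (1 + eps / 2) ^+ K :> R.
  exists (Num.truncn (2 / eps)).+1; apply: le_trans (bernoulli _ _); last by rewrite divr_ge0 // ltW.
  by have := truncnS_gt (2 / eps); rewrite ltr_pdivrMr //; lra.
exists (ratio_const eps), (round_const eps cW K); split.
- by rewrite /ratio_const mulr_gt0 // exprn_gt0 // addr_gt0.
- exact: lt_le_trans (round_const_ge1 _ _ _).
(* Choice fixes an algorithm and a number of rounds for each pair of n and [alpha]; both constants
   were fixed before [dec]. *)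
move=> dec; have [AT ATP] := choice (fun p : nat * nat =>
  @algorithm_for_parameters R eps cId cMsg cW K eps_gt0 cMsg_gt0 K_ge2 (dec p.1) p.1 p.2).
exists (dispatch (fun p => (AT p).1)), (fun n alpha => (AT (n, alpha)).2).
move=> N alpha w idN [fp _] w0 repr.
have [[X run approx] bound] := ATP (#|N|, alpha) N w erefl idN fp w0 repr.
have [mb out] := runs_dispatch (A := fun p => (AT p).1) run; split=> //.
by rewrite (funext out).
Qed.
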